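(* Let $X$ be a real Banach space and let $Y$ be a closed subspace of $X$. Then the following are equivalent: (1) $Y$ has property-$(HB)$ in $X$. (2) $Y^\#$ is a closed (linear) subspace of $X^*$ and $X^*=Y^\#\oplus Y^\perp$, with $\|x^*\|\ge\|y^\perp\|$ whenever $x^*=y^\#+y^\perp$, $y^\#\in Y^\#$ and $y^\perp\in Y^\perp$.
   Context: $Y^\perp=\{x^*\in X^*: x^*(y)=0\ \forall y\in Y\}$ and $Y^\#=\{x^*\in X^*:\|x^*\|=\|x^*|_Y\|\}$ (in general only a subset of $X^*$). $Y$ has property-$(HB)$ in $X$ if there is a closed subspace $G$ of $X^*$ with $X^*=G\oplus Y^\perp$ such that for each $x^*\in X^*$, $\|x^*\|>\|y^\#\|$ and $\|x^*\|\ge\|y^\perp\|$ whenever $x^*=y^\#+y^\perp$ with $y^\#\in G$ and $0\ne y^\perp\in Y^\perp$. *)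

(* Defs.v *)
From HB Require Import structures.
From mathcomp Require Import all_boot all_order all_algebra.
From mathcomp Require Import all_classical all_reals all_analysis.

Set Implicit Arguments.
Unset Strict Implicit.
Unset Printing Implicit Defensive.

Import Order.TTheory GRing.Theory Num.Theory.
Import numFieldNormedType.Exports.

Local Open Scope classical_set_scope.
Local Open Scope ring_scope.

Definition continuous_functional (R : realType) (X : normedModType R) :
  {pred X -> R^o} := fun f => `[< linear f /\ continuous f >].

Record dual (R : realType) (X : normedModType R) : Type := Dual {
  dual_val :> X -> R^o ;
  dual_valP : dual_val \in @continuous_functional R X }.

(* The supremum over the closed unit ball of Y, i.e., the norm of the restriction
   of f to the subspace Y; Y = setT gives the dual norm. Only used for bounded f
   and Y containing 0, where sup does not fall back to its default value. *)
Definition norm_on (R : realType) (X : normedModType R) (Y : set X)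
    (f : X -> R^o) : R :=
  sup [set `|f y| | y in Y `&` [set y | `|y| <= 1]].

Section dual_normedModType.
Variables (R : realType) (X : normedModType R).

HB.instance Definition _ := [isSub for @dual_val R X].
HB.instance Definition _ := [Choice of dual X by <:].

Lemma continuous_functional_submod_closed :
  submod_closed (@continuous_functional R X).
Proof.
split.
  apply/asboolP; split; last by move=> x; exact: cst_continuous.
  by move=> a x y /=; rewrite scaler0 addr0.
move=> a f g /asboolP[lf cf] /asboolP[lg cg]; apply/asboolP; split.
  move=> b x y /=; rewrite !fctE lf lg !scalerDr !scalerA mulrC.
  by rewrite -!addrA; congr (_ + _); rewrite addrCA.
move=> x; apply: (@continuousD R R^o X _ g) => //; last exact: cg.
by apply: continuousZr; exact: cf.
Qed.

HB.instance Definition _ := GRing.isSubmodClosed.Build R (X -> R^o)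
  (@continuous_functional R X) continuous_functional_submod_closed.

HB.instance Definition _ := [SubChoice_isSubLmodule of dual X by <:].

Lemma dual_linear (f : dual X) : linear f.
Proof. by have /asboolP[] := dual_valP f. Qed.

HB.instance Definition _ (f : dual X) :=
  GRing.isLinear.Build R X R^o _ (dual_val f) (dual_linear f).

Lemma dual_continuous (f : dual X) : continuous f.
Proof. by have /asboolP[] := dual_valP f. Qed.

Lemma dual_bounded (f : dual X) : exists2 M : R, 0 < M &
  forall x, `|f x| <= M * `|x|.
Proof.
have /linear_bounded_continuous/linear_boundedP/pinfty_ex_gt0 [M M0 Mf] :
  continuous (dual_val f) by exact: dual_continuous.
by exists M.
Qed.

Lemma norm_on_has_ubound (Y : set X) (f : dual X) :
  has_ubound [set `|f y| | y in Y `&` [set y | `|y| <= 1]].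
Proof.
have [M M0 Mf] := dual_bounded f; exists M => _ [y [_ /= y1] <-].
by rewrite (le_trans (Mf y))// ler_piMr// ltW.
Qed.

Let dual_norm (f : dual X) : R := norm_on setT f.

Let dual_norm_ub (f : dual X) y : `|y| <= 1 -> `|f y| <= dual_norm f.
Proof.
by move=> y1; apply: ub_le_sup; [exact: norm_on_has_ubound|exists y].
Qed.

Let dual_norm_le (f : dual X) M :
  (forall y, `|y| <= 1 -> `|f y| <= M) -> dual_norm f <= M.
Proof.
move=> fM; apply: ge_sup; last by move=> _ [y [_ /= y1] <-]; exact: fM.
by exists `|f 0|, 0 => //; split => //=; rewrite normr0.
Qed.

Let dual_normD f g : dual_norm (f + g) <= dual_norm f + dual_norm g.
Proof.
apply: dual_norm_le => y y1; rewrite (le_trans (ler_normD _ _))//.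
by rewrite lerD// dual_norm_ub.
Qed.

Let dual_normZ_le a f : dual_norm (a *: f) <= `|a| * dual_norm f.
Proof.
apply: dual_norm_le => y y1.
by rewrite [leLHS]normrM ler_wpM2l// dual_norm_ub.
Qed.

Let dual_norm0_eq0 f : dual_norm f = 0 -> f = 0.
Proof.
move=> f0; apply: val_inj; apply/funext => x; change (f x = 0).
have [->|x0] := eqVneq x 0; first exact: linear0.
have : `|f (`|x|^-1 *: x)| <= 0.
  by rewrite -f0 dual_norm_ub// normrZ normfV normr_id mulVf ?normr_eq0.
rewrite normr_le0 linearZ /= mulf_eq0 invr_eq0 normr_eq0 (negPf x0) /=.
by move/eqP.
Qed.

Let dual_normZ a f : dual_norm (a *: f) = `|a| * dual_norm f.
Proof.
have [->|a0] := eqVneq a 0.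
  apply/eqP; rewrite eq_le dual_normZ_le normr0 mul0r /=.
  by rewrite (le_trans (normr_ge0 _) (@dual_norm_ub _ 0 _))// normr0.
apply/eqP; rewrite eq_le dual_normZ_le /=.
rewrite -ler_pdivlMl ?normr_gt0// -normfV.
by rewrite -[in leLHS](scalerK a0 f) dual_normZ_le.
Qed.

HB.instance Definition _ := Lmodule_isNormed.Build R (dual X)
  dual_normD dual_normZ dual_norm0_eq0.

Lemma dual_normE (f : dual X) : `|f| = norm_on setT f.
Proof. by []. Qed.

End dual_normedModType.

Definition closed_subspace (R : realType) (V : normedModType R) (S : set V) :=
  submod_closed (mem S) /\ closed S.

(* Internal direct sum; G and H are meant to be linear subspaces. *)
Definition direct_sum (R : realType) (V : normedModType R) (G H : set V) :=
  (forall v, exists g h, [/\ G g, H h & v = g + h]) /\ G `&` H = [set 0].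

Definition annihilator (R : realType) (X : normedModType R) (Y : set X) :
  set (dual X) := [set f : dual X | forall y, Y y -> f y = 0].

(* The set Y^#, in general not a linear subspace. *)
Definition norm_preserving (R : realType) (X : normedModType R) (Y : set X) :
  set (dual X) := [set f : dual X | `|f| = norm_on Y f].

Definition property_HB (R : realType) (X : normedModType R) (Y : set X) :=
  exists G : set (dual X),
    [/\ closed_subspace G, direct_sum G (annihilator Y) &
      forall f g h : dual X, f = g + h -> G g -> annihilator Y h -> h != 0 ->
        `|g| < `|f| /\ `|h| <= `|f|].

(* Main.v *)
From HB Require Import structures.
Require Import Defs.
From mathcomp Require Import all_boot all_order all_algebra.
From mathcomp Require Import all_classical all_reals all_analysis.
From mathcomp Require Import lra.
Import Order.TTheory GRing.Theory Num.Theory.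
Import numFieldNormedType.Exports.
Local Open Scope classical_set_scope.
Local Open Scope ring_scope.

(** The two conditions are linked by the fact that a complement [G] of
    [annihilator Y] witnessing property (HB) can only be [norm_preserving Y].

    Write [f = g + h] with [g] in [G] and [h] in the annihilator of [Y], so that
    [f] and [g] agree on [Y].  If [h != 0], property (HB) makes [f] strictly
    longer than [g], hence strictly longer than its own restriction to [Y]: a
    norm-preserving functional must therefore lie in [G].  Conversely, for [g]
    in [G], the Hahn-Banach theorem gives an [f] that agrees with [g] on [Y] and
    whose norm is the norm of [g] on [Y], so at most [`|g|]; the same strict
    inequality then forces [f = g] (lemma [property_HB_complement]).  Condition
    (2) is thus what property (HB) says of [G].

    From (2) to (1), [norm_preserving Y] is itself the witness: for
    [f = g + h] with [h != 0], [`|g|] is the norm of [f] on [Y], so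
    [`|g| <= `|f|], and equality would make [f] norm-preserving, hence [h] a
    common element of the two summands.

    The Hahn-Banach theorem is proved by applying Zorn's lemma to graphs of
    dominated linear functionals on subspaces. *)

(** * The Hahn-Banach theorem *)

Section HahnBanach.
Variables (R : realType) (V : lmodType R) (p : V -> R).

(** Graphs of linear functionals bounded by [p] on their domain.  For
    positively homogeneous [p], domination already makes such a linear relation
    single-valued ([dominated_graph_fun]); every clause of the definition
    passes to unions of nonempty chains. *)
Definition dominated_graph (A : set (V * R^o)) :=
  [/\ A 0, forall a u v, A u -> A v -> A (a *: u + v) &
      forall u, A u -> u.2 <= p u.1].

Hypothesis pD : forall x y, p (x + y) <= p x + p y.
Hypothesis pZ : forall a x, 0 <= a -> p (a *: x) = a * p x.

Lemma dominated_graphZ A a u : dominated_graph A -> A u -> A (a *: u).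
Proof. by move=> [A0 Al _] Au; rewrite -[a *: u]addr0; exact: Al. Qed.

Lemma dominated_graphB A u v : dominated_graph A -> A u -> A v -> A (u - v).
Proof. by move=> [_ Al _] Au Av; rewrite addrC -scaleN1r; exact: Al. Qed.

(** If [A] relates [x] to [r] and to [s], then it relates [0] to [r - s] and to
    [s - r], and both are at most [p 0 = 0]. *)
Lemma dominated_graph_fun A x r s :
  dominated_graph A -> A (x, r) -> A (x, s) -> r = s.
Proof.
move=> dA; have p0 : p 0 = 0 by rewrite -(scale0r 0) pZ// mul0r.
have le r' s' : A (x, r') -> A (x, s') -> r' <= s'.
  move=> Ar As; have [_ _ /(_ _ (dominated_graphB _ _ _ dA Ar As))] := dA.
  by rewrite /= subrr p0 subr_le0.
by move=> Ar As; apply/eqP; rewrite eq_le !le.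
Qed.

(** The admissible values at a new point [x] are those between
    [r - p (y - x)] and [p (z + x) - s], for [(y, r)] and [(z, s)] in the graph;
    subadditivity puts every lower bound below every upper bound. *)
Lemma dominated_extension_value A x : dominated_graph A ->
  exists c, forall u, A u ->
    u.2 + c <= p (u.1 + x) /\ u.2 - c <= p (u.1 - x).
Proof.
move=> [A0 Al Ap].
pose L := [set u.2 - p (u.1 - x) | u in A].
have Lub v : A v -> ubound L (p (v.1 + x) - v.2).
  move=> Av _ [u Au <-].
  have /Ap /= : A (1 *: u + v) by exact: Al.
  rewrite !scale1r => uv.
  have := pD (u.1 - x) (v.1 + x).
  rewrite addrACA addNr addr0; lra.
have L0 : L !=set0 by exists (0 - p (0 - x)), 0.
exists (sup L) => u Au; split.
  have : sup L <= p (u.1 + x) - u.2 by apply: ge_sup => //; exact: Lub.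
  lra.
have : u.2 - p (u.1 - x) <= sup L.
  apply: ub_le_sup; last by exists u.
  by exists (p (u.1 + x) - u.2); exact: Lub.
lra.
Qed.

Lemma dominated_graph_extend A x : dominated_graph A ->
  exists B, [/\ dominated_graph B, A `<=` B & exists r, B (x, r)].
Proof.
move=> dA; have [c Ac] := dominated_extension_value A x dA.
have [A0 Al Ap] := dA.
exists [set w | exists u t, A u /\ w = u + t *: (x, c)]; split; first split.
- by exists 0, 0; split => //; rewrite scale0r addr0.
- move=> a _ _ [u [s [Au ->]]] [v [t [Av ->]]].
  exists (a *: u + v), (a * s + t); split; first exact: Al.
  by rewrite scalerDr scalerDl scalerA addrACA.
- move=> _ [u [t [Au ->]]] /=.
  (* By homogeneity it is enough to treat t = 1 and t = -1, which is how c was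
     chosen. *)
  have [t0|t0|->] := ltgtP t 0; last by rewrite !scale0r !addr0; exact: Ap.
  + have [_] := Ac _ (dominated_graphZ _ (- t)^-1 _ dA Au).
    have nt0 : 0 < - t by rewrite oppr_gt0.
    rewrite -(ler_pM2l nt0) -pZ ?(ltW nt0)// scalerBr scalerA mulrBr.
    rewrite divff ?gt_eqF// scale1r scaleNr opprK mulrA divff ?gt_eqF// mul1r.
    by rewrite mulNr opprK.
  + have [+ _] := Ac _ (dominated_graphZ _ t^-1 _ dA Au).
    rewrite -(ler_pM2l t0) -pZ ?(ltW t0)// scalerDr scalerA mulrDr.
    by rewrite divff ?gt_eqF// scale1r mulrA divff ?gt_eqF// mul1r.
- by move=> u Au; exists u, 0; rewrite scale0r addr0.
- by exists c, 0, 1; rewrite scale1r add0r.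
Qed.

Lemma dominated_graph_maximal A0 : dominated_graph A0 ->
  exists M, [/\ dominated_graph M, A0 `<=` M &
    forall B, dominated_graph B -> M `<=` B -> B = M].
Proof.
move=> dA0.
(* The empty set stands for A0, so that the union of the empty chain is
   admissible. *)
pose P A := dominated_graph (A0 `|` A).
have [F FP totF|A [PA Amax]] := @Zorn_bigcup _ P; last first.
  exists (A0 `|` A); split => // B dB AB; apply: contrapT => BA.
  apply: (Amax B); last first.
    by rewrite /P (setUidPr _ _).2 //; exact: subset_trans AB.
  split; first exact: subset_trans AB.
  by move=> BsubA; apply: BA; apply/seteqP; split => // u /BsubA; right.
pose U := \bigcup_(B in F) B.
have P0 : P set0 by rewrite /P setU0.
have common u v : (A0 `|` U) u -> (A0 `|` U) v ->
    exists B, [/\ P B, B `<=` U, (A0 `|` B) u & (A0 `|` B) v].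
  have FU B : F B -> B `<=` U by move=> FB w Bw; exists B.
  move=> [uA|[B FB Bu]] [vA|[C FC Cv]].
  - by exists set0; split => //; left.
  - by exists C; split; [exact: FP|exact: FU|left|right].
  - by exists B; split; [exact: FP|exact: FU|right|left].
  - have [BC|CB] := totF _ _ FB FC.
      by exists C; split; [exact: FP|exact: FU|right; exact: BC|right].
    by exists B; split; [exact: FP|exact: FU|right|right; exact: CB].
rewrite /P -/U; split.
- by left; have [] := dA0.
- move=> a u v Uu Uv; have [B [[_ Bl _] BU Bu Bv]] := common _ _ Uu Uv.
  by have [|/BU] := Bl a _ _ Bu Bv; [left|right].
- by move=> u Uu; have [B [[_ _ Bp] _ /Bp]] := common _ _ Uu Uu.
Qed.

Theorem hahn_banach (Y : set V) (g : V -> R^o) :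
  submod_closed (mem Y) ->
  {in Y &, forall x y, forall a, g (a *: x + y) = a *: g x + g y} ->
  {in Y, forall x, g x <= p x} ->
  exists f : V -> R^o,
    [/\ linear f, {in Y, f =1 g} & forall x, f x <= p x].
Proof.
move=> [Y0 Yl] gl gp.
have g0 : g 0 = 0.
  by have := gl _ _ Y0 Y0 (-1); rewrite scaler0 addr0 scaleN1r addNr.
have [|M [dM GM Mmax]] := dominated_graph_maximal [set (y, g y) | y in Y].
  split.
  - by exists 0; [exact: set_mem|rewrite g0].
  - move=> a _ _ [x /mem_set Yx <-] [y /mem_set Yy <-].
    exists (a *: x + y); first by apply: set_mem; exact: Yl.
    by rewrite gl.
  - by move=> _ [x /mem_set Yx <-]; exact: gp.
have domM x : exists r, M (x, r).
  by have [B [dB /(Mmax _ dB) ->]] := dominated_graph_extend M x dM.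
pose f x : R^o := sval (cid (domM x)).
have Mf x : M (x, f x) by rewrite /f; case: cid.
have [_ Ml Mp] := dM.
exists f; split.
- move=> a x y; apply: (dominated_graph_fun _ _ _ _ dM (Mf _)).
  exact: Ml a _ _ (Mf x) (Mf y).
- move=> x /set_mem Yx; apply: (dominated_graph_fun _ _ _ _ dM (Mf x)).
  by apply: GM; exists x.
- by move=> x; exact: Mp (Mf x).
Qed.

End HahnBanach.

(** * Norms of restrictions *)

Section RestrictedNorm.
Variables (R : realType) (X : normedModType R).
Implicit Types (f g h : dual X) (Y : set X).

Lemma norm_on_le Y f : submod_closed (mem Y) -> norm_on Y f <= `|f|.
Proof.
move=> [/set_mem Y0 _]; rewrite dual_normE; apply: ge_sup.
  by exists `|f 0|, 0 => //; split => //=; rewrite normr0.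
move=> _ [y [_ /= y1] <-]; apply: ub_le_sup; first exact: norm_on_has_ubound.
by exists y.
Qed.

Lemma eq_norm_on Y (f g : X -> R^o) : {in Y, f =1 g} -> norm_on Y f = norm_on Y g.
Proof.
move=> fg; congr sup; apply: eq_imagel => y [Yy _].
by rewrite fg// inE.
Qed.

Lemma norm_on_ge0 Y f : submod_closed (mem Y) -> 0 <= norm_on Y f.
Proof.
move=> [/set_mem Y0 _]; apply: (le_trans (normr_ge0 (f 0))).
apply: ub_le_sup; first exact: norm_on_has_ubound.
by exists 0 => //; split => //=; rewrite normr0.
Qed.

Lemma norm_on_bound Y f y : submod_closed (mem Y) -> Y y ->
  `|f y| <= norm_on Y f * `|y|.
Proof.
move=> [Y0 Yl] Yy; have [->|y0] := eqVneq y 0.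
  by rewrite linear0 !normr0 mulr0.
have ny : 0 < `|y| by rewrite normr_gt0.
rewrite -ler_pdivrMr//.
have -> : `|f y| / `|y| = `|f (`|y|^-1 *: y)|.
  by rewrite linearZ normrZ normfV normr_id mulrC.
apply: ub_le_sup; first exact: norm_on_has_ubound.
exists (`|y|^-1 *: y) => //; split => /=.
  by apply: set_mem; rewrite -[_ *: y]addr0; apply: Yl => //; exact: mem_set.
by rewrite normrZ normfV normr_id mulVf ?gt_eqF.
Qed.

(** The sublinear bound is [norm_on Y g * `|x|], the least multiple of the norm
    that dominates [g] on [Y]. *)
Lemma norm_preserving_extension Y g : submod_closed (mem Y) ->
  exists f, norm_preserving Y f /\ {in Y, f =1 g}.
Proof.
move=> sY; have N0 := norm_on_ge0 Y g sY.
have [||||f [fl fg fp]] := @hahn_banach R X (fun x => norm_on Y g * `|x|)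
    _ _ Y g sY.
- by move=> x y; rewrite -mulrDr ler_wpM2l// ler_normD.
- by move=> a x a0; rewrite normrZ ger0_norm// mulrCA.
- by move=> x y _ _ a; rewrite linearP.
- move=> x /set_mem Yx; apply: (le_trans (ler_norm _)).
  exact: norm_on_bound.
pose F : {linear X -> R^o} :=
  HB.pack f (GRing.isLinear.Build R X R^o *:%R f fl).
have f_bound x : `|f x| <= norm_on Y g * `|x|.
  rewrite ler_norml fp andbT lerNl -(normrN x).
  apply: le_trans (fp (- x)).
  by rewrite (linearN F x : f (- x) = - f x).
have fc : f \in @continuous_functional R X.
  apply/asboolP; split => //.
  apply: (@linear_bounded_continuous _ _ _ F).1.
  apply/linear_boundedP; exists (norm_on Y g); split; first exact: num_real.
  move=> M /ltW gM x; apply: le_trans (f_bound x) _.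
  by rewrite ler_wpM2r.
exists (Dual fc); split => //.
apply/eqP; rewrite eq_le norm_on_le// andbT.
rewrite (eq_norm_on Y (Dual fc) g fg) dual_normE; apply: ge_sup.
  by exists `|f 0|, 0 => //; split => //=; rewrite normr0.
move=> _ [x [_ /= x1] <-]; apply: le_trans (f_bound x) _.
by rewrite ler_piMr.
Qed.

(** * The complement in property (HB) *)

Lemma dual_valB f g x : (f - g) x = f x - g x.
Proof. by []. Qed.

Lemma annihilator_eq_on Y f g : annihilator Y (f - g) <-> {in Y, f =1 g}.
Proof.
split=> [fg y /set_mem /fg /eqP|fg y Yy].
  by rewrite dual_valB subr_eq0 => /eqP.
by rewrite dual_valB (fg _ (mem_set Yy)) subrr.
Qed.

Lemma eq_on_addl_annihilator {Y} g {h} : annihilator Y h -> {in Y, g + h =1 g}.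
Proof. by move=> Yh; apply/annihilator_eq_on; rewrite addrC addKr. Qed.

(** Both inclusions say that a norm-preserving [f] agreeing with [g] in [G] on
    [Y] equals [g]: otherwise [`|g| < `|f|], while [`|f|] is the norm of [g] on
    [Y]. *)
Lemma property_HB_complement Y (G : set (dual X)) : submod_closed (mem Y) ->
  (forall f, exists g h, [/\ G g, annihilator Y h & f = g + h]) ->
  (forall f g h, f = g + h -> G g -> annihilator Y h -> h != 0 -> `|g| < `|f|) ->
  G = norm_preserving Y.
Proof.
move=> sY GY ltGY.
have np_eq f g : norm_preserving Y f -> G g -> {in Y, f =1 g} -> f = g.
  move=> npf Gg fg; apply/eqP; rewrite -subr_eq0; apply: contraT => h0.
  have : `|g| < `|f|.
    apply: (ltGY f g (f - g)) => //; first by rewrite addrC subrK.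
    exact/annihilator_eq_on.
  by rewrite npf (eq_norm_on Y f g fg) ltNge norm_on_le.
apply/seteqP; split=> [g Gg|f npf].
  have [f [npf fg]] := norm_preserving_extension Y g sY.
  by rewrite -(np_eq f g).
have [g [h [Gg Yh fE]]] := GY f.
by rewrite (np_eq f g)// fE; exact: eq_on_addl_annihilator.
Qed.

End RestrictedNorm.

Theorem theorem2p8 (R : realType) (X : completeNormedModType R) (Y : set X)
    (closedY : closed_subspace Y) :
  property_HB Y <->
  [/\ closed_subspace (norm_preserving Y),
      direct_sum (norm_preserving Y) (annihilator Y) &
      forall f g h : dual X, f = g + h -> norm_preserving Y g ->
        annihilator Y h -> `|h| <= `|f|].
Proof.
have [sY _] := closedY; split=> [[G [cG dG leG]]|[cN dN leN]].
  have GE : G = norm_preserving Y.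
    apply: property_HB_complement => //; first by case: dG.
    by move=> f g h fE Gg Yh h0; have [] := leG f g h fE Gg Yh h0.
  rewrite -GE; split => // f g h fE Gg Yh.
  have [->|h0] := eqVneq h 0; first by rewrite normr0.
  by have [] := leG f g h fE Gg Yh h0.
exists (norm_preserving Y); split => // f g h fE npg Yh h0.
split; last exact: leN fE npg Yh.
have fg : norm_on Y g = norm_on Y f.
  by apply/esym/eq_norm_on; rewrite fE; exact: eq_on_addl_annihilator.
rewrite npg fg lt_neqAle norm_on_le// andbT; apply: contra_neq h0 => npf.
have [_ N0] := dN; rewrite -[h = 0]/([set 0] h) -N0; split => //.
have [[_ Nl] _] := cN.
have -> : h = -1 *: g + f by rewrite scaleN1r fE addKr.
by apply: set_mem; apply: Nl; exact: mem_set.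
Qed.
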